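(* Let $P_i,Q_i\subset\mathbb{E}_i$, $i=1,\ldots,l$, be $0$-symmetric convex bodies in Euclidean spaces. If $\otimes_\alpha$ is a tensor product (of order $l$) of $0$-symmetric convex bodies, then $$\delta^{BM}\left(P_1\otimes_\alpha\cdots\otimes_\alpha P_l,\,Q_1\otimes_\alpha\cdots\otimes_\alpha Q_l\right)\le\delta^{BM}(P_1,Q_1)\cdots\delta^{BM}(P_l,Q_l).$$
   Context: A Euclidean space is a finite dimensional real inner product space; $\mathbb{E}_i,\mathbb{F}_i$ denote Euclidean spaces. $\otimes_{i=1}^l\mathbb{E}_i$ carries the scalar product determined by $\langle x^1\otimes\cdots\otimes x^l,y^1\otimes\cdots\otimes y^l\rangle_H=\prod_i\langle x^i,y^i\rangle_{\mathbb{E}_i}$. A convex body is a compact convex set with nonempty interior; it is $0$-symmetric if $P=-P$. The polar of $C$ is $C^\circ=\{y:\sup_{x\in C}\langle x,y\rangle\le1\}$ (with respect to $\langle\cdot,\cdot\rangle_H$ in tensor product spaces). For convex bodies $P_i\subset\mathbb{E}_i$ with $0$ in the interior, $P_1\otimes_\pi\cdots\otimes_\pi P_l:=\mathrm{conv}\{x^1\otimes\cdots\otimes x^l:x^i\in P_i\}$ and $P_1\otimes_\epsilon\cdots\otimes_\epsilon P_l:=(P_1^\circ\otimes_\pi\cdots\otimes_\pi P_l^\circ)^\circ$. A tensor product $\otimes_\alpha$ of order $l$ of $0$-symmetric convex bodies assigns to each $l$-tuple of $0$-symmetric convex bodies $P_i\subset\mathbb{E}_i$ a $0$-symmetric convex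 body $P_1\otimes_\alpha\cdots\otimes_\alpha P_l\subset\otimes_{i=1}^l\mathbb{E}_i$ such that (1) $P_1\otimes_\pi\cdots\otimes_\pi P_l\subseteq P_1\otimes_\alpha\cdots\otimes_\alpha P_l\subseteq P_1\otimes_\epsilon\cdots\otimes_\epsilon P_l$; (2) (uniform property) for all linear $T_i:\mathbb{E}_i\to\mathbb{F}_i$ and $0$-symmetric convex bodies $Q_i\subset\mathbb{F}_i$ with $T_i(P_i)\subseteq Q_i$, $T_1\otimes\cdots\otimes T_l(P_1\otimes_\alpha\cdots\otimes_\alpha P_l)\subseteq Q_1\otimes_\alpha\cdots\otimes_\alpha Q_l$. The Banach-Mazur distance between $0$-symmetric convex bodies $P,Q$ in a Euclidean space $\mathbb{E}$ is $\delta^{BM}(P,Q):=\inf\{\lambda\ge1:\text{there is a bijective linear map }T:\mathbb{E}\to\mathbb{E}\text{ with }Q\subseteq TP\subseteq\lambda Q\}$. *)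

(* Defs.v *)
From HB Require Import structures.
From mathcomp Require Import all_boot all_order all_algebra.
From mathcomp Require Import sesquilinear.
From mathcomp Require Import all_classical all_reals all_analysis.
From mathcomp Require Import ring.

Set Implicit Arguments.
Unset Strict Implicit.
Unset Printing Implicit Defensive.

Import Order.TTheory GRing.Theory Num.Theory.
Import numFieldNormedType.Exports.

Local Open Scope classical_set_scope.
Local Open Scope ring_scope.

Record euclidean (R : realType) := Euclidean {
  euclidean_space : vectType R ;
  euclidean_dot : {dot euclidean_space for (@idfun R)} }.

(* The carrier is an alias of [euclidean_space E], so that the topology it
   receives below is the one given by the inner product, whatever other
   structures [euclidean_space E] may have. *)
Definition euclidean_sort (R : realType) (E : euclidean R) : Type :=
  euclidean_space E.
Coercion euclidean_sort : euclidean >-> Sortclass.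

HB.instance Definition _ (R : realType) (E : euclidean R) :=
  Vector.copy (euclidean_sort E) (euclidean_space E).

Definition inner (R : realType) (E : euclidean R) (x y : E) : R :=
  euclidean_dot E x y.

Notation "''[' x , y ]" := (inner x y) : ring_scope.

Section Inner.
Context {R : realType} {E : euclidean R}.
Implicit Types x y z : E.

Lemma innerC x y : '[x, y] = '[y, x].
Proof. by rewrite /inner (hermC (euclidean_dot E) x y) /= expr0 mul1r. Qed.

Lemma innerDl x y z : '[x + y, z] = '[x, z] + '[y, z].
Proof. exact: (linearDl (euclidean_dot E)). Qed.

Lemma innerZl (a : R) x y : '[a *: x, y] = a * '[x, y].
Proof. exact: (linearZl_LR (euclidean_dot E)). Qed.

Lemma innerDr x y z : '[x, y + z] = '[x, y] + '[x, z].
Proof. by rewrite innerC innerDl !(innerC x). Qed.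

Lemma innerZr (a : R) x y : '[x, a *: y] = a * '[x, y].
Proof. by rewrite innerC innerZl innerC. Qed.

Lemma inner0l x : '[0, x] = 0.
Proof. by rewrite -(scale0r (0 : E)) innerZl mul0r. Qed.

Lemma inner0r x : '[x, 0] = 0.
Proof. by rewrite innerC inner0l. Qed.

Lemma inner_suml (I : Type) (s : seq I) (P : pred I) (F : I -> E) y :
  '[\sum_(i <- s | P i) F i, y] = \sum_(i <- s | P i) '[F i, y].
Proof.
by elim/big_rec2: _ => [|i a b _ <-]; rewrite ?inner0l ?innerDl.
Qed.

Lemma inner_sumr (I : Type) (s : seq I) (P : pred I) (F : I -> E) y :
  '[y, \sum_(i <- s | P i) F i] = \sum_(i <- s | P i) '[y, F i].
Proof. by rewrite innerC inner_suml; under eq_bigr do rewrite innerC. Qed.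

Lemma inner_gt0 x : x != 0 -> 0 < '[x, x].
Proof. exact: (@neq0_dnorm_gt0 _ _ _ (euclidean_dot E)). Qed.

Lemma inner_ge0 x : 0 <= '[x, x].
Proof.
by have [->|/inner_gt0/ltW//] := eqVneq x 0; rewrite inner0l.
Qed.

Definition euclidean_norm x : R := Num.sqrt '[x, x].

Lemma inner_cauchy_schwarz x y : '[x, y] <= euclidean_norm x * euclidean_norm y.
Proof.
have [->|x0] := eqVneq x 0.
  by rewrite inner0l mulr_ge0 // sqrtr_ge0.
have xx := inner_gt0 x0.
have := inner_ge0 (y - ('[x, y] / '[x, x]) *: x).
rewrite -scaleNr innerDl !innerDr !innerZl !innerZr (innerC y x).
rewrite [leRHS](_ : _ = '[y, y] - '[x, y] ^+ 2 / '[x, x]); last first.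
  by field; rewrite gt_eqF.
rewrite subr_ge0 ler_pdivrMr // mulrC => h.
rewrite (le_trans (ler_norm _)) // -sqrtr_sqr -sqrtrM ?inner_ge0 //.
by rewrite ler_sqrt // mulr_ge0 ?inner_ge0.
Qed.

Lemma euclidean_normD x y :
  euclidean_norm (x + y) <= euclidean_norm x + euclidean_norm y.
Proof.
have nx : 0 <= euclidean_norm x by exact: sqrtr_ge0.
have ny : 0 <= euclidean_norm y by exact: sqrtr_ge0.
rewrite -[leRHS]ger0_norm ?addr_ge0 // -sqrtr_sqr /euclidean_norm ler_sqrt ?sqr_ge0 //.
rewrite sqrrD !sqr_sqrtr ?inner_ge0 // innerDl !innerDr (innerC y x) addrA.
rewrite lerD2r -addrA lerD2l -mulr2n lerMn2r; exact: inner_cauchy_schwarz.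
Qed.

Lemma euclidean_normZ (a : R) x :
  euclidean_norm (a *: x) = `|a| * euclidean_norm x.
Proof.
by rewrite /euclidean_norm innerZl innerZr mulrA -expr2 sqrtrM ?sqr_ge0 // sqrtr_sqr.
Qed.

Lemma euclidean_norm_eq0 x : euclidean_norm x = 0 -> x = 0.
Proof.
move/eqP; rewrite sqrtr_eq0 => x0; apply/eqP; apply: contraTT x0.
by rewrite -ltNge; exact: inner_gt0.
Qed.

End Inner.

HB.instance Definition _ (R : realType) (E : euclidean R) :=
  Lmodule_isNormed.Build R (euclidean_sort E)
    (@euclidean_normD R E) (@euclidean_normZ R E) (@euclidean_norm_eq0 R E).

Lemma normE (R : realType) (E : euclidean R) (x : E) : `|x| = Num.sqrt '[x, x].
Proof. by []. Qed.

Section OrthonormalBasis.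
Context {R : realType} (E : euclidean R).

Let orthonormal_family n (b : 'I_n -> E) :=
  forall i j, '[b i, b j] = (i == j)%:R.

Lemma orthonormal_free n (b : 'I_n -> E) :
  orthonormal_family b -> free [tuple b i | i < n].
Proof.
move=> ob; apply/freeP => k k0 i.
have := congr1 (fun z => '[z, b i]) k0; rewrite inner0l inner_suml.
under eq_bigr do rewrite -tnth_nth tnth_mktuple innerZl ob.
rewrite (bigD1 i) //= eqxx mulr1 big1 ?addr0 // => j ji.
by rewrite (negPf ji) mulr0.
Qed.

Lemma orthonormal_basis_exists :
  exists b : 'I_(\dim {:E}) -> E, orthonormal_family b.
Proof.
suff: forall n, (n <= \dim {:E})%N ->
  exists b : 'I_n -> E, orthonormal_family b by exact.
elim=> [|n IH] nE; first by exists (fun=> 0) => -[].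
have [b ob] := IH (ltnW nE).
have [v vb] : exists v : E, v \notin <<[tuple b i | i < n]>>%VS.
  apply: contrapT => /forallNP h.
  have : ({:E} <= <<[tuple b i | i < n]>>)%VS.
    by apply/subvP => v _; have /negP/negPn := h v.
  move=> /dimvS/leq_trans/(_ (dim_span _)); rewrite size_tuple.
  by rewrite leqNgt nE.
pose w := v - \sum_(i < n) '[v, b i] *: b i.
have w0 : w != 0.
  apply: contra vb; rewrite subr_eq0 => /eqP ->; apply: rpred_sum => i _.
  apply: rpredZ; apply: memv_span; apply/tnthP; exists i.
  by rewrite tnth_mktuple.
have wb i : '[w, b i] = 0.
  rewrite /w -scaleN1r innerDl innerZl inner_suml (bigD1 i) //= big1 => [|j ji].
    by rewrite innerZl ob eqxx mulr1 addr0 mulN1r subrr.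
  by rewrite innerZl ob (negPf ji) mulr0.
pose e := (Num.sqrt '[w, w])^-1 *: w.
have eb i : '[e, b i] = 0 by rewrite innerZl wb mulr0.
have ee : '[e, e] = 1.
  rewrite innerZl innerZr mulrA -invfM -expr2 sqr_sqrtr ?inner_ge0 //.
  by rewrite mulVf // gt_eqF // inner_gt0.
exists (fun i : 'I_n.+1 => oapp b e (unlift ord_max i)) => i j.
case: (unliftP ord_max i) => [i'|] ->; case: (unliftP ord_max j) => [j'|] -> /=.
- by rewrite ob (inj_eq lift_inj).
- by rewrite innerC eb eq_sym (negPf (neq_lift _ _)).
- by rewrite eb (negPf (neq_lift _ _)).
- by rewrite ee eqxx.
Qed.

Definition onb : 'I_(\dim {:E}) -> E := projT1 (cid orthonormal_basis_exists).

Lemma onbP i j : '[onb i, onb j] = (i == j)%:R.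
Proof. exact: (projT2 (cid orthonormal_basis_exists)). Qed.

Lemma onb_expand (x : E) : x = \sum_i '[onb i, x] *: onb i.
Proof.
have bas : basis_of {:E} [tuple onb i | i < \dim {:E}].
  by rewrite basisEfree (orthonormal_free onbP) subvf size_tuple /= leqnn.
have [c xE] : exists c : 'I_(\dim {:E}) -> R,
    x = \sum_i c i *: [tuple onb i | i < \dim {:E}]`_i.
  by eexists; exact: (coord_basis bas (memvf x)).
rewrite {1}xE; apply: eq_bigr => i _.
rewrite -tnth_nth tnth_mktuple; congr (_ *: _).
rewrite xE inner_sumr.
under eq_bigr do rewrite -tnth_nth tnth_mktuple innerZr onbP.
rewrite (bigD1 i) //= eqxx mulr1 big1 ?addr0 // => j ji.
by rewrite eq_sym (negPf ji) mulr0.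
Qed.

Lemma onb_parseval (x y : E) : '[x, y] = \sum_i '[onb i, x] * '[onb i, y].
Proof.
rewrite {1}(onb_expand x) inner_suml.
by apply: eq_bigr => i _; rewrite innerZl.
Qed.

End OrthonormalBasis.

Arguments onb {R} E _.

Lemma prod_sum_dffun (R : comNzRingType) (I : finType) (T : I -> finType)
    (P : forall i, T i -> R) :
  \prod_i \sum_(k : T i) P i k = \sum_(j : {dffun forall i, T i}) \prod_i P i (j i).
Proof.
pose Q i := [ffun k : T i => P i k].
transitivity (\prod_i \sum_(k in tagged_with T i) untag 0 (Q i) k).
  apply: eq_bigr => i _; rewrite -(big_tag (fun i k => Q i k) i).
  by apply: eq_bigr => k _; rewrite ffunE.
rewrite bigA_distr_big_dep.
rewrite (reindex (@dffun_of_fprod _ T)) /=; last first.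
  exact/onW_bij/dffun_of_fprod_bij.
transitivity (\sum_(t : fprod T) \prod_i Q i (t i)).
  by rewrite big_fprod; apply: eq_bigl => g; rewrite inE.
by apply: eq_bigr => t _; apply: eq_bigr => i _; rewrite !ffunE.
Qed.

Section Tensor.
Context {R : realType} {l : nat}.
Implicit Types E F : 'I_l -> euclidean R.

Definition tensor_index E := {dffun forall i, 'I_(\dim {:E i})}.

(* An element of the tensor product is the family of its coordinates in the
   basis of all the onb (E 0) (j 0) (x) ... (x) onb (E l.-1) (j l.-1); these
   form an orthonormal basis, which yields the inner product. *)
Definition tensor_coords E : Type := {ffun tensor_index E -> R^o}.

HB.instance Definition _ E := Vector.on (tensor_coords E).

Definition tensor_dot E (u v : tensor_coords E) : R := \sum_j u j * v j.

Lemma tensor_dot_bilinear E :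
  bilinear_for *%R (@idfun R \; *%R) (@tensor_dot E).
Proof.
split=> u a x y; rewrite /tensor_dot /= mulr_sumr -big_split /=;
  apply: eq_bigr => j _; rewrite !ffunE /GRing.scale /=; ring.
Qed.

HB.instance Definition _ E :=
  bilinear_isBilinear.Build R (tensor_coords E) (tensor_coords E) R
    *%R (@idfun R \; *%R) (@tensor_dot E) (@tensor_dot_bilinear E).

Lemma tensor_dot_sym E (u v : tensor_coords E) :
  tensor_dot u v = (-1) ^+ false * idfun (tensor_dot v u).
Proof. by rewrite mul1r; apply: eq_bigr => j _; rewrite mulrC. Qed.

HB.instance Definition _ E :=
  isHermitianSesquilinear.Build R (tensor_coords E) false (@idfun R)
    (@tensor_dot E) (@tensor_dot_sym E).

Lemma tensor_dot_gt0 E (u : tensor_coords E) : u != 0 -> 0 < tensor_dot u u.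
Proof.
move=> u0; have nn j : true -> 0 <= u j * u j by rewrite -expr2 sqr_ge0.
rewrite lt0r sumr_ge0 // andbT; apply: contra u0 => /eqP s0.
apply/eqP/ffunP => j; rewrite ffunE; apply/eqP.
by have /eqP := psumr_eq0P nn s0 (i := j) isT; rewrite mulf_eq0 orbb.
Qed.

HB.instance Definition _ E :=
  isDotProduct.Build R (tensor_coords E) (@tensor_dot E) (@tensor_dot_gt0 E).

Definition tensor E : euclidean R :=
  @Euclidean R (tensor_coords E) (@tensor_dot E).

Definition pure E (x : forall i, E i) : tensor E :=
  [ffun j : tensor_index E => \prod_i '[onb (E i) (j i), x i] : R^o].

Definition tensor_basis E (j : tensor_index E) : tensor E :=
  pure (fun i => onb (E i) (j i)).

Definition tensor_map_fun E F (T : forall i, 'Hom(E i, F i)) (u : tensor E) :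
    tensor F :=
  \sum_(j : tensor_index E) '[tensor_basis j, u] *:
    pure (fun i => T i (onb (E i) (j i))).

Lemma tensor_map_is_linear E F (T : forall i, 'Hom(E i, F i)) :
  linear (tensor_map_fun T).
Proof.
move=> a u v; rewrite /tensor_map_fun scaler_sumr -big_split /=.
by apply: eq_bigr => j _; rewrite innerDr innerZr scalerDl scalerA.
Qed.

HB.instance Definition _ E F (T : forall i, 'Hom(E i, F i)) :=
  GRing.isLinear.Build R (tensor E) (tensor F) *:%R (tensor_map_fun T)
    (tensor_map_is_linear T).

Definition tensor_map E F (T : forall i, 'Hom(E i, F i)) :
    'Hom(tensor E, tensor F) := linfun (tensor_map_fun T).

Lemma inner_pure E (x y : forall i, E i) :
  '[pure x, pure y] = \prod_i '[x i, y i].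
Proof.
transitivity (\sum_(j : tensor_index E) \prod_i
    ('[onb (E i) (j i), x i] * '[onb (E i) (j i), y i])).
  by apply: eq_bigr => j _; rewrite !ffunE -big_split.
under [RHS]eq_bigr do rewrite onb_parseval.
by rewrite prod_sum_dffun.
Qed.

Lemma tensor_basis_inner E (j k : tensor_index E) :
  '[tensor_basis j, tensor_basis k] = (j == k)%:R.
Proof.
rewrite inner_pure; have [->|jk] := eqVneq j k.
  by rewrite big1 // => i _; rewrite onbP eqxx.
have [i ji] : exists i, j i != k i.
  apply/existsP; rewrite -negb_forall; apply: contra jk => /forallP h.
  by apply/eqP/ffunP => i; exact/eqP.
by rewrite (bigD1 i) //= onbP (negPf ji) mul0r.
Qed.

Lemma tensor_basis_coord E (j : tensor_index E) (u : tensor E) :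
  '[tensor_basis j, u] = u j.
Proof.
have bk k : (tensor_basis j) k = (j == k)%:R.
  rewrite -tensor_basis_inner inner_pure ffunE.
  by apply: eq_bigr => i _; rewrite innerC.
rewrite [LHS](bigD1 j) //= bk eqxx mul1r big1 ?addr0 // => k kj.
by rewrite bk eq_sym (negPf kj) mul0r.
Qed.

Lemma tensor_basis_expand E (u : tensor E) :
  u = \sum_j '[tensor_basis j, u] *: tensor_basis j.
Proof.
apply/ffunP => k; rewrite -tensor_basis_coord {1}/tensor_basis.
rewrite -[RHS]tensor_basis_coord inner_sumr (bigD1 k) //= innerZr.
rewrite tensor_basis_inner eqxx mulr1 big1 ?addr0 // => j jk.
by rewrite innerZr tensor_basis_inner eq_sym (negPf jk) mulr0.
Qed.

Lemma tensor_map_pure E F (T : forall i, 'Hom(E i, F i)) (x : forall i, E i) :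
  tensor_map T (pure x) = pure (fun i => T i (x i)).
Proof.
rewrite lfunE /= /tensor_map_fun; apply/ffunP => k.
rewrite -!tensor_basis_coord inner_sumr inner_pure.
under [RHS]eq_bigr => i _.
  rewrite {1}(onb_expand (x i)) linear_sum inner_sumr.
  under eq_bigr do rewrite linearZ innerZr.
  over.
rewrite prod_sum_dffun; apply: eq_bigr => j _.
by rewrite innerZr !inner_pure -big_split.
Qed.

End Tensor.

Section ConvexBodies.
Context {R : realType}.
Implicit Type E : euclidean R.

Definition convex_body E (P : set E) :=
  [/\ compact P, convex_set P & P° !=set0].

Definition sym_convex_body E (P : set E) :=
  convex_body P /\ [set - x | x in P] = P.

Definition conv E (A : set E) : set E := smallest (@convex_set R E) A.

Definition polar E (C : set E) : set E :=
  [set y : E | (ereal_sup [set '[x, y]%:E | x in C] <= 1)%E].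

(* Valued in \bar R, so that the infimum over an empty set would be +oo and
   not the conventional value 0 of a real infimum. *)
Definition banach_mazur E (P Q : set E) : \bar R :=
  ereal_inf [set lambda%:E | lambda in [set lambda : R | 1 <= lambda /\
    exists T : 'End(E), [/\ bijective T, Q `<=` T @` P
                           & T @` P `<=` [set lambda *: q | q in Q]]]].

End ConvexBodies.

Section BodyTensor.
Context {R : realType} {l : nat}.
Implicit Types E F : 'I_l -> euclidean R.

Definition tensor_pi E (P : forall i, set (E i)) : set (tensor E) :=
  conv [set pure x | x in [set x : forall i, E i | forall i, P i (x i)]].

Definition tensor_eps E (P : forall i, set (E i)) : set (tensor E) :=
  polar (tensor_pi (fun i => polar (P i))).

(* The values of alpha on families that are not all 0-symmetric convex bodies
   are irrelevant. *)
Definition body_tensor_product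
    (alpha : forall E, (forall i, set (E i)) -> set (tensor E)) : Prop :=
  [/\ forall E (P : forall i, set (E i)),
         (forall i, sym_convex_body (P i)) -> sym_convex_body (alpha E P),
      forall E (P : forall i, set (E i)),
         (forall i, sym_convex_body (P i)) ->
         tensor_pi P `<=` alpha E P /\ alpha E P `<=` tensor_eps P
    & forall E F (T : forall i, 'Hom(E i, F i))
         (P : forall i, set (E i)) (Q : forall i, set (F i)),
         (forall i, sym_convex_body (P i)) ->
         (forall i, sym_convex_body (Q i)) ->
         (forall i, T i @` P i `<=` Q i) ->
         tensor_map T @` alpha E P `<=` alpha F Q].

End BodyTensor.

(* Main.v *)
Require Import Defs.
From mathcomp Require Import all_boot all_order all_algebra.
From mathcomp Require Import all_classical all_reals all_analysis.

(** If [Q i `<=` T i @` P i `<=` lambda i *: Q i] for every [i], then [T i]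
    followed by division by [lambda i] maps [P i] into [Q i], and the inverse
    of [T i] maps [Q i] into [P i].  The uniform property turns these into
    inclusions between [alpha E P] and [alpha E Q], and as the tensor product
    of maps is multilinear and functorial they say that the tensor product of
    the [T i] sandwiches [alpha E P] between [alpha E Q] and its dilate by the
    product of the [lambda i] ([tensor_sandwich]).  So every product of
    admissible dilation factors is admissible for the tensor bodies.  Passing
    to infima one factor at a time ([le_prod_ereal_inf]) gives the bound; all
    factors being at least [1], no product [0 * +oo] can occur. *)

Set Implicit Arguments.
Unset Strict Implicit.
Unset Printing Implicit Defensive.

Import Order.TTheory GRing.Theory Num.Theory.

Local Open Scope classical_set_scope.
Local Open Scope ring_scope.

(** * Products of infima *)

Section ProductsOfInfima.
Context {R : realType}.
Implicit Types (A : set R) (y K : \bar R).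

Lemma ereal_inf_ge1 A :
  A `<=` [set a | 1 <= a] -> (1 <= ereal_inf [set a%:E | a in A])%E.
Proof.
by move=> A1; apply: le_ereal_inf_tmp => _ [a Aa <-]; rewrite lee_fin; exact: A1.
Qed.

Lemma prode_ge1 n (f : 'I_n -> \bar R) :
  (forall i, 1 <= f i)%E -> (1 <= \prod_(i < n) f i)%E.
Proof.
move=> f1; elim/big_ind: _ => // u v u1 v1.
by rewrite -[leLHS]mule1 lee_pmul.
Qed.

(** For finite [K] this is division by [K]; for [K = +oo] the right-hand side
    is [+oo], because the infimum is positive. *)
Lemma le_mul_ereal_inf A y K : (0 < K)%E -> A `<=` [set a | 1 <= a] ->
  (forall a, A a -> y <= K * a%:E)%E ->
  (y <= K * ereal_inf [set a%:E | a in A])%E.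
Proof.
move=> K0 A1 yK; have inf1 := ereal_inf_ge1 A1.
case: K K0 yK => [k| |//] k0 yK; last first.
  by rewrite gt0_mulye ?leey // (lt_le_trans _ inf1) // lte01.
rewrite lte_fin in k0.
rewrite muleC -lee_pdivrMr //; apply: le_ereal_inf_tmp => _ [a Aa <-].
by rewrite lee_pdivrMr // muleC; exact: yK.
Qed.

(** The constant [c] carries the factors already chosen in the induction on the
    number of sets. *)
Lemma le_prod_ereal_inf n (A : 'I_n -> set R) (c : R) y : 0 < c ->
  (forall i, A i `<=` [set a | 1 <= a]) ->
  (forall a : 'I_n -> R, (forall i, A i (a i)) ->
     (y <= (c * \prod_(i < n) a i)%:E)%E) ->
  (y <= c%:E * \prod_(i < n) ereal_inf [set a%:E | a in A i])%E.
Proof.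
elim: n => [|n IHn] in A c *; move=> c0 A1 yA.
  by have := yA (fun=> 0) (fun i => False_ind _ (notF (ltn_ord i)));
    rewrite !big_ord0 mulr1 mule1.
have inf1 i := ereal_inf_ge1 (A1 i).
rewrite big_ord_recl [X in (_ * X)%E]muleC muleA; apply: le_mul_ereal_inf => //.
  rewrite mule_gt0 ?lte_fin // (lt_le_trans _ (prode_ge1 _)) ?lte01 // => i.
move=> a0 Aa0; rewrite muleAC -EFinM.
have a0_gt0 : 0 < a0 by rewrite (lt_le_trans ltr01) //; exact: A1 Aa0.
apply: (IHn (fun i => A (lift ord0 i))) => [|//|a Aa]; first exact: mulr_gt0.
have := yA (fun i => oapp a a0 (unlift ord0 i)).
rewrite big_ord_recl unlift_none /= mulrA.
under eq_bigr do rewrite liftK /=.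
by apply => i; case: (unliftP ord0 i) => [j|] ->.
Qed.

End ProductsOfInfima.

(** * Tensor products of linear maps *)

Section TensorMap.
Context {R : realType} {l : nat}.
Implicit Types E F G : 'I_l -> euclidean R.

(** Pure tensors span, so it suffices to compare on them. *)
Lemma tensor_map_ext E F (f g : 'Hom(tensor E, tensor F)) :
  (forall x : forall i, E i, f (pure x) = g (pure x)) -> f = g.
Proof.
move=> fg; apply/lfunP => u; rewrite (tensor_basis_expand u) !linear_sum.
by apply: eq_bigr => j _; rewrite !linearZ /= fg.
Qed.

Lemma pureZ E (a : 'I_l -> R) (x : forall i, E i) :
  pure (fun i => a i *: x i) = (\prod_(i < l) a i) *: pure x.
Proof.
apply/ffunP => j; rewrite !ffunE -[RHS]big_split /=.
by apply: eq_bigr => i _; rewrite innerZr.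
Qed.

Lemma tensor_mapZ E F (a : 'I_l -> R) (T : forall i, 'Hom(E i, F i)) :
  tensor_map (fun i => a i *: T i) = (\prod_(i < l) a i) *: tensor_map T.
Proof.
apply: tensor_map_ext => x; rewrite scale_lfunE !tensor_map_pure -pureZ.
by congr pure; apply: functional_extensionality_dep => i; rewrite scale_lfunE.
Qed.

Lemma tensor_mapK E F (T : forall i, 'Hom(E i, F i))
    (S : forall i, 'Hom(F i, E i)) :
  (forall i, cancel (T i) (S i)) -> cancel (tensor_map T) (tensor_map S).
Proof.
move=> TK u; rewrite -comp_lfunE -[RHS]id_lfunE; congr (fun_of_lfun _ u).
apply: tensor_map_ext => x; rewrite comp_lfunE !tensor_map_pure id_lfunE.
by congr pure; apply: functional_extensionality_dep => i; rewrite TK.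
Qed.

End TensorMap.

(** * Dilation factors of tensor bodies *)

Section DilationFactors.
Context {R : realType}.

Lemma bijective_lfun_inv (E : euclidean R) (T : 'End(E)) : bijective T ->
  cancel T (T^-1)%VF /\ cancel (T^-1)%VF T.
Proof.
move=> bT; have kT : lker T == 0%VS by apply/lker0P/bij_inj.
by split; [exact: lker0_lfunK|exact: lker0_lfunVK].
Qed.

(** The set whose infimum defines the Banach-Mazur distance. *)
Definition dilation_factors (E : euclidean R) (P Q : set E) : set R :=
  [set lambda : R | 1 <= lambda /\
    exists T : 'End(E), [/\ bijective T, Q `<=` T @` P
                           & T @` P `<=` [set lambda *: q | q in Q]]].

Context {l : nat}.

Lemma tensor_sandwich
    (alpha : forall E : 'I_l -> euclidean R,
       (forall i : 'I_l, set (E i)) -> set (tensor E))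
    (E : 'I_l -> euclidean R) (P Q : forall i, set (E i))
    (T : forall i, 'End(E i)) (lambda : 'I_l -> R) :
  body_tensor_product alpha ->
  (forall i, sym_convex_body (P i)) -> (forall i, sym_convex_body (Q i)) ->
  (forall i, bijective (T i)) -> (forall i, lambda i != 0) ->
  (forall i, Q i `<=` T i @` P i) ->
  (forall i, T i @` P i `<=` [set lambda i *: q | q in Q i]) ->
  [/\ bijective (tensor_map T), alpha E Q `<=` tensor_map T @` alpha E P
    & tensor_map T @` alpha E P `<=`
      [set (\prod_(i < l) lambda i) *: q | q in alpha E Q]].
Proof.
move=> [_ _ uniform] hP hQ bT lambda0 QTP TPQ.
have TK := tensor_mapK (fun i => (bijective_lfun_inv (bT i)).1).
have VK := tensor_mapK (fun i => (bijective_lfun_inv (bT i)).2).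
split; first by exists (tensor_map (fun i => (T i)^-1)%VF).
- move=> v Qv; exists (tensor_map (fun i => (T i)^-1)%VF v); last exact: VK.
  apply: (uniform E E _ Q P) => // [i|]; last by exists v.
  move=> _ [q Qq <-]; have [p Pp <-] := QTP i q Qq.
  by rewrite (bijective_lfun_inv (bT i)).1.
- move=> _ [u Pu <-].
  have Lambda0 : \prod_(i < l) lambda i != 0 by apply/prodf_neq0.
  exists (tensor_map (fun i => (lambda i)^-1 *: T i) u); last first.
    by rewrite tensor_mapZ scale_lfunE scalerA prodfV mulfV ?scale1r.
  apply: (uniform E E _ P Q) => // [i|]; last by exists u.
  move=> _ [p Pp <-]; have [q Qq qE] := TPQ i _ (imageP (T i) Pp).
  by rewrite scale_lfunE -qE scalerA mulVf ?scale1r.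
Qed.

Lemma dilation_factors_tensor
    (alpha : forall E : 'I_l -> euclidean R,
       (forall i : 'I_l, set (E i)) -> set (tensor E))
    (E : 'I_l -> euclidean R) (P Q : forall i, set (E i))
    (lambda : 'I_l -> R) :
  body_tensor_product alpha ->
  (forall i, sym_convex_body (P i)) -> (forall i, sym_convex_body (Q i)) ->
  (forall i, dilation_factors (P i) (Q i) (lambda i)) ->
  dilation_factors (alpha E P) (alpha E Q) (\prod_(i < l) lambda i).
Proof.
move=> halpha hP hQ hlambda; split.
  by elim/big_ind: _ => // [u v|i _]; [exact: mulr_ege1|exact: (hlambda i).1].
pose T i := projT1 (cid (hlambda i).2).
have hT i := projT2 (cid (hlambda i).2).
exists (tensor_map T); apply: tensor_sandwich => // i; rewrite ?/T.
- by case: (hT i).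
- by rewrite gt_eqF // (lt_le_trans ltr01) //; exact: (hlambda i).1.
- by case: (hT i).
- by case: (hT i).
Qed.

End DilationFactors.

Theorem proposition3p5 (R : realType) (l : nat)
    (alpha : forall E : 'I_l -> euclidean R,
       (forall i : 'I_l, set (E i)) -> set (tensor E))
    (halpha : body_tensor_product alpha)
    (E : 'I_l -> euclidean R) (P Q : forall i : 'I_l, set (E i))
    (hP : forall i : 'I_l, sym_convex_body (P i))
    (hQ : forall i : 'I_l, sym_convex_body (Q i)) :
  (banach_mazur (alpha E P) (alpha E Q) <=
     \prod_(i < l) banach_mazur (P i) (Q i))%E.
Proof.
rewrite -[leRHS]mul1e.
apply: (@le_prod_ereal_inf R l (fun i => dilation_factors (P i) (Q i)) 1).
- exact: ltr01.
- by move=> i a [].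
move=> lambda hlambda; rewrite mul1r; apply: ereal_inf_lbound.
by exists (\prod_(i < l) lambda i) => //; exact: dilation_factors_tensor.
Qed.
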